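(* Let $\Omega\subseteq\mathbb{R}^n$ be open and let $\breve F:\Omega\to K(\mathbb{R})$ be continuously differentiable (in the sense of the Markov difference). Let $x\in\Omega$ and $d\in\mathbb{R}^n$. If $$\sum_{i=1}^n d_i\odot\breve g_i(x)\prec\breve 0,$$ where $\breve g_i(x)=\frac{\partial\breve F(x)}{\partial x_i}$ and the sum is interval (Minkowski) addition, then $d$ is a descent direction of $\breve F$ at $x$.
   Context: $K(\mathbb{R})$ is the set of compact intervals $\breve\alpha=[\underline\alpha,\overline\alpha]$, $\underline\alpha\le\overline\alpha$; $\breve 0=[0,0]$. $\breve\alpha\oplus\breve\beta=[\underline\alpha+\underline\beta,\overline\alpha+\overline\beta]$; for a real $r$, $r\odot\breve\alpha=\{ra:a\in\breve\alpha\}$ (division by a real $h\neq0$ means $\frac1h\odot$). The Markov difference is $$\breve\alpha\ominus_M\breve\beta=\left[\min\{\underline\alpha-\underline\beta,\overline\alpha-\overline\beta\},\max\{\underline\alpha-\underline\beta,\overline\alpha-\overline\beta\}\right].$$ The strict order is $\breve\alpha\prec\breve\beta\iff\underline\alpha<\underline\beta$ and $\overline\alpha<\overline\beta$. Limits and continuity in $K(\mathbb{R})$ are with respect to the metric $d(\breve\alpha,\breve\beta)=\max\{|\underline\alpha-\underline\beta|,|\overline\alpha-\overline\beta|\}$. The partial derivative of $\breve F$ at $x$ with respect to the $i$-th variable is $$\frac{\partial\breve F(x)}{\partial x_i}=\lim_{h_i\to0}\frac{\breve F(x_1,\dots,x_{i-1},x_i+h_i,x_{i+1},\dots,x_n)\ominus_M\breve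 F(x)}{h_i}\in K(\mathbb{R}),$$ if this limit exists; it is denoted $\breve g_i(x)=[\underline g_i(x),\overline g_i(x)]$ (when the endpoint functions $\underline F,\overline F$ of $\breve F=[\underline F,\overline F]$ have partial derivatives, $\underline g_i$ and $\overline g_i$ are respectively the minimum and maximum of $\frac{\partial\underline F}{\partial x_i},\frac{\partial\overline F}{\partial x_i}$). $\breve F$ is differentiable at $x_0$ if all partial derivatives at $x_0$ exist and there is an interval-valued function $\breve E_{x_0}$ with $\lim_{\|h\|\to0}\breve E_{x_0}(h)=\breve 0$ such that, for some $\delta>0$ and all $\|h\|<\delta$, $$\breve F(x_0+h)\ominus_M\breve F(x_0)=\left(\sum_{i=1}^n h_i\odot\frac{\partial\breve F(x_0)}{\partial x_i}\right)\oplus\|h\|\odot\breve E_{x_0}(h),$$ the sum being with respect to $\oplus$. $\breve F$ is continuously differentiable on $\Omega$ if it is differentiable at every point of $\Omega$ and each $\breve g_i:\Omega\to K(\mathbb{R})$ is continuous. A vector $d\in\mathbb{R}^n$ is a descent direction of $\breve F$ at $x$ if there is $\delta>0$ such that $\breve F(x+\alpha d)\prec\breve F(x)$ for all $\alpha\in(0,\delta)$ (in particular $x+\alpha d$ lies in the domain for these $\alpha$). *)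

(* Defs.v *)
From HB Require Import structures.
From mathcomp Require Import all_boot all_order all_algebra.
From mathcomp Require Import all_classical all_reals all_analysis.
From mathcomp Require Import lra.

Set Implicit Arguments.
Unset Strict Implicit.
Unset Printing Implicit Defensive.

Import Order.TTheory GRing.Theory Num.Theory.
Import numFieldNormedType.Exports.

Local Open Scope classical_set_scope.
Local Open Scope ring_scope.

(* K(R): a compact interval is encoded by its endpoints; the set it denotes is
   [citv_set]. *)
Record citv (R : realType) := CItv {
  citv_pair : R * R ;
  citv_pairP : citv_pair.1 <= citv_pair.2 }.

HB.instance Definition _ (R : realType) := [isSub for @citv_pair R].
HB.instance Definition _ (R : realType) := [Choice of citv R by <:].

Section CompactIntervals.
Context {R : realType}.
Implicit Types (a b c : citv R) (r u v : R).

Definition lo a : R := (citv_pair a).1.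
Definition hi a : R := (citv_pair a).2.

Definition citv_set a : set R := [set` `[lo a, hi a]].

Lemma lo_le_hi a : lo a <= hi a.
Proof. exact: citv_pairP. Qed.

Lemma citv_eqP a b : a = b <-> lo a = lo b /\ hi a = hi b.
Proof.
split=> [->//|[]]; case: a b => [[a1 a2] pa] [[b1 b2] pb].
by rewrite /lo /hi /= => e1 e2; apply/val_inj; rewrite /= e1 e2.
Qed.

Lemma hull_subproof u v :
  (Num.min u v, Num.max u v).1 <= (Num.min u v, Num.max u v).2.
Proof. by rewrite /= ge_min !le_max lexx. Qed.

Definition hull u v : citv R := CItv (hull_subproof u v).

Lemma citv_add_subproof a b :
  (lo a + lo b, hi a + hi b).1 <= (lo a + lo b, hi a + hi b).2.
Proof. by rewrite /= lerD// lo_le_hi. Qed.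

Definition citv_add a b : citv R := CItv (citv_add_subproof a b).

Definition citv0 : citv R := CItv (lexx (0, 0).1 : (0, 0).1 <= (0, 0).2).

Definition citv_scale r a : citv R := hull (r * lo a) (r * hi a).

Lemma citv_scale_set r a :
  citv_set (citv_scale r a) = [set r * x | x in citv_set a].
Proof.
rewrite /citv_set /citv_scale /lo /hi /=; apply/seteqP.
case: a => -[l h] /= lh; split => [y|_ [x + <-]] /=; rewrite !in_itv /=.
  rewrite ge_min le_max => /andP[y1 y2].
  have [r0|r0|r0] := ltgtP r 0.
  - exists (r^-1 * y); rewrite ?mulVKf ?lt_eqF// in_itv /=.
    rewrite mulrC ler_ndivlMr// ler_ndivrMr//.
    by rewrite (mulrC h) (mulrC l); nra.
  - exists (r^-1 * y); rewrite ?mulVKf ?gt_eqF// in_itv /=.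
    rewrite mulrC ler_pdivlMr// ler_pdivrMr//.
    by rewrite (mulrC h) (mulrC l); nra.
  - exists l; first by rewrite in_itv /= lexx.
    by move: y1 y2; rewrite r0 !mul0r !orbb => y1 y2; apply/le_anti/andP.
move=> /andP[lx xh]; rewrite ge_min le_max.
have [r0|/ltW r0] := leP 0 r.
  by rewrite (ler_wpM2l r0 lx) (ler_wpM2l r0 xh) orbT.
by rewrite (ler_wnM2l r0 lx) (ler_wnM2l r0 xh) orbT.
Qed.

Definition markov_sub a b : citv R := hull (lo a - lo b) (hi a - hi b).

Definition citv_lt a b : bool := (lo a < lo b) && (hi a < hi b).

Definition citv_dist a b : R :=
  Num.max `|lo a - lo b| `|hi a - hi b|.

Lemma citv_distxx a : citv_dist a a = 0.
Proof. by rewrite /citv_dist !subrr normr0 maxxx. Qed.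

Lemma citv_dist_positivity a b : citv_dist a b = 0 -> a = b.
Proof.
rewrite /citv_dist => d0; apply/citv_eqP; split; apply/eqP.
  by rewrite -subr_eq0 -normr_le0 -d0 le_max lexx.
by rewrite -subr_eq0 -normr_le0 -d0 le_max lexx orbT.
Qed.

Lemma citv_dist_sym a b : citv_dist a b = citv_dist b a.
Proof. by rewrite /citv_dist distrC (distrC (hi a)). Qed.

Lemma citv_dist_triangle b a c :
  citv_dist a c <= citv_dist a b + citv_dist b c.
Proof.
rewrite /citv_dist ge_max; apply/andP; split.
  by rewrite (le_trans (ler_distD (lo b) _ _))// lerD// le_max lexx.
by rewrite (le_trans (ler_distD (hi b) _ _))// lerD// le_max lexx orbT.
Qed.

Lemma citv_addA : associative citv_add.
Proof. by move=> a b c; apply/citv_eqP; rewrite /lo /hi /= !addrA. Qed.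

Lemma citv_addC : commutative citv_add.
Proof.
by move=> a b; apply/citv_eqP; rewrite /lo /hi /=; split; rewrite addrC.
Qed.

Lemma citv_add0 : left_id citv0 citv_add.
Proof. by move=> a; apply/citv_eqP; rewrite /lo /hi /= !add0r. Qed.

End CompactIntervals.

(* Hence [a + b], [0] and [\sum] on [citv R] are interval addition, [0, 0] and
   iterated interval addition. *)
HB.instance Definition _ (R : realType) :=
  GRing.isNmodule.Build (citv R) (@citv_addA R) (@citv_addC R) (@citv_add0 R).
HB.instance Definition _ (R : realType) := isPointed.Build (citv R) 0.
HB.instance Definition _ (R : realType) := isMetric.Build R (citv R)
  (@citv_distxx R) (@citv_dist_positivity R) (@citv_dist_sym R)
  (@citv_dist_triangle R).

Notation "r ⊙ a" := (citv_scale r a) (at level 40) : ring_scope.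
Notation "a ⊖ b" := (markov_sub a b) (at level 50, left associativity)
  : ring_scope.
Notation "a ≺ b" := (citv_lt a b) (at level 70) : ring_scope.

Section MarkovCalculus.
Context {R : realType} {n : nat}.
Implicit Types (Omega : set 'rV[R]_n) (F : 'rV[R]_n -> citv R).
Implicit Types (x h d : 'rV[R]_n) (i : 'I_n).

(* The norm [`|h|] that the library puts on row vectors is the max norm. *)
Definition enorm h : R := Num.sqrt (\sum_(i < n) h ord0 i ^+ 2).

(* A function on an open set [Omega] is represented by a total function whose
   values outside [Omega] are irrelevant. *)
Definition mquot F x i (t : R) : citv R :=
  t^-1 ⊙ (F (x + t *: delta_mx ord0 i) ⊖ F x).

Definition mpartial_exists F x i : Prop := cvg (mquot F x i t @[t --> (0 : R)^']).

(* Meaningful only when [mpartial_exists F x i]. *)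
Definition mpartial F x i : citv R := lim (mquot F x i t @[t --> (0 : R)^']).

Definition mdifferentiable_at Omega F x : Prop :=
  (forall i, mpartial_exists F x i) /\
  exists E : 'rV[R]_n -> citv R,
    E h @[h --> (0 : 'rV[R]_n)^'] --> (0 : citv R) /\
    exists2 delta : R, 0 < delta &
      forall h, enorm h < delta ->
        Omega (x + h) /\
        F (x + h) ⊖ F x =
          (\sum_(i < n) h ord0 i ⊙ mpartial F x i) + enorm h ⊙ E h.

Definition continuously_mdifferentiable Omega F : Prop :=
  (forall x, Omega x -> mdifferentiable_at Omega F x) /\
  forall i, {within Omega, continuous (fun x => mpartial F x i)}.

Definition descent_direction Omega F x d : Prop :=
  exists2 delta : R, 0 < delta &
    forall alpha : R, 0 < alpha < delta ->
      Omega (x + alpha *: d) /\ F (x + alpha *: d) ≺ F x.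

End MarkovCalculus.

(* Main.v *)
Require Import Defs.
From mathcomp Require Import all_boot all_order all_algebra.
From mathcomp Require Import all_classical all_reals all_analysis.

Import Order.TTheory GRing.Theory Num.Theory.
Import numFieldNormedType.Exports.

Local Open Scope classical_set_scope.
Local Open Scope ring_scope.

(* Along the ray the error is o(alpha), so for small alpha > 0 the upper endpoint
   of F (x + alpha d) ⊖ F x is negative. That endpoint is the larger of the
   increments of the two endpoint functions, hence both increments are
   negative. *)

Lemma hi0 (R : realType) : hi (0 : citv R) = 0.
Proof. by []. Qed.

Lemma hiD (R : realType) (a b : citv R) : hi (a + b) = hi a + hi b.
Proof. by []. Qed.

Lemma hi_sum (R : realType) (I : Type) (r : seq I) (P : pred I)
    (f : I -> citv R) :
  hi (\sum_(i <- r | P i) f i) = \sum_(i <- r | P i) hi (f i).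
Proof. exact: (big_morph hi (@hiD R) (hi0 R)). Qed.

(** A nonnegative factor passes through the maximum that defines [hi], while [r] may have either
    sign. This pulls the step length out of each term of the directional sum. *)
Lemma hi_scaleM (R : realType) (a r : R) (b : citv R) :
  0 <= a -> hi ((a * r) ⊙ b) = a * hi (r ⊙ b).
Proof. by move=> a0; rewrite /hi /= maxr_pMr// !mulrA. Qed.

Lemma hi_scale_ge0 (R : realType) (a : R) (b : citv R) :
  0 <= a -> hi (a ⊙ b) = a * hi b.
Proof.
by move=> a0; rewrite {1}/hi /= max_r// ler_wpM2l// lo_le_hi.
Qed.

Lemma hi_markov_sub_lt0 (R : realType) (a b : citv R) :
  hi (a ⊖ b) < 0 -> a ≺ b.
Proof. by rewrite {1}/hi /= gt_max !subr_lt0. Qed.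

Lemma enorm_ge0 (R : realType) (n : nat) (h : 'rV[R]_n) : 0 <= enorm h.
Proof. exact: sqrtr_ge0. Qed.

Lemma enormZ (R : realType) (n : nat) (a : R) (h : 'rV[R]_n) :
  enorm (a *: h) = `|a| * enorm h.
Proof.
rewrite /enorm -sqrtr_sqr -sqrtrM ?sqr_ge0// mulr_sumr.
by congr Num.sqrt; apply: eq_bigr => i _; rewrite mxE exprMn.
Qed.

Lemma hi_sum_scale0 (R : realType) (n : nat) (g : 'I_n -> citv R) :
  hi (\sum_(i < n) (0 : 'rV[R]_n) ord0 i ⊙ g i) = 0.
Proof.
rewrite hi_sum big1// => i _.
by rewrite mxE hi_scale_ge0// mul0r.
Qed.

(** Restricts a punctured limit at the origin to a ray: [d != 0] keeps [a *: d] off the origin, and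
    [a < e / |d|] keeps it in the ball of radius [e], with [|d|] the max norm that defines the
    topology. *)
Lemma near_scale_dnbhs0 (R : realType) (n : nat) (d : 'rV[R]_n)
    (P : set 'rV[R]_n) :
  d != 0 -> (\forall h \near (0 : 'rV[R]_n)^', P h) ->
  \forall a \near (0 : R)^'+, P (a *: d).
Proof.
move=> d0 /nbhs_ballP[e /= e0 eP].
have nd : 0 < `|d| by rewrite normr_gt0.
near=> a.
have a0 : 0 < a by near: a; exact: nbhs_right_gt.
apply: eP; last by rewrite /= scaler_eq0 negb_or d0 gt_eqF.
rewrite -ball_normE /= sub0r normrN normrZ gtr0_norm// -ltr_pdivlMr//.
by near: a; apply: nbhs_right_lt; rewrite divr_gt0.
Unshelve. all: by end_near. Qed.

Theorem theorem3p2 (R : realType) (n : nat) (Omega : set 'rV[R]_n)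
    (F : 'rV[R]_n -> citv R) (x d : 'rV[R]_n) :
  open Omega ->
  continuously_mdifferentiable Omega F ->
  Omega x ->
  (\sum_(i < n) d ord0 i ⊙ mpartial F x i) ≺ 0 ->
  descent_direction Omega F x d.
Proof.
move=> _ [diffF _] Ox /andP[_]; rewrite hi0.
set S := hi _ => S0.
(* For [d = 0] the sum would have upper endpoint 0, against [S < 0]. *)
have d0 : d != 0.
  by apply/eqP => d0; move: S0; rewrite /S d0 hi_sum_scale0 ltxx.
have [_ [E [E0 [delta delta0 expand]]]] := diffF x Ox.
have nd1 : 0 < enorm d + 1 by rewrite ltr_wpDl// enorm_ge0.
(* This bound on [hi (E h)] is chosen so that its product with [enorm d] stays below [- S]; the
   [+ 1] makes the denominator visibly positive and the inequality strict. *)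
have eps0 : 0 < - S / (enorm d + 1) by rewrite divr_gt0// oppr_gt0.
have hiE : \forall h \near (0 : 'rV[R]_n)^', hi (E h) < - S / (enorm d + 1).
  move/cvg_ballP: E0 => /(_ _ eps0); apply: filterS => h.
  rewrite ballEmdist /= => /(le_lt_trans _); apply.
  rewrite /mdist /= /citv_dist le_max; apply/orP; right.
  by rewrite hi0 sub0r normrN ler_norm.
have hiEray := near_scale_dnbhs0 _ _ d _ d0 hiE.
have : \forall a \near (0 : R)^'+,
    Omega (x + a *: d) /\ F (x + a *: d) ≺ F x.
  near=> a.
  have a0 : 0 < a by near: a; exact: nbhs_right_gt.
  have norm_ad : enorm (a *: d) = a * enorm d by rewrite enormZ gtr0_norm.
  (* It suffices that [a < delta / (enorm d + 1)]. *)
  have ad_lt : enorm (a *: d) < delta.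
    rewrite norm_ad (@le_lt_trans _ _ (a * (enorm d + 1)))//.
      by rewrite ler_pM2l// lerDl.
    rewrite -ltr_pdivlMr//.
    by near: a; apply: nbhs_right_lt; rewrite divr_gt0.
  have [Oad Fad] := expand _ ad_lt.
  split=> //; apply: hi_markov_sub_lt0; rewrite Fad.
  rewrite hiD hi_scale_ge0 ?enorm_ge0// norm_ad.
  have -> : hi (\sum_(i < n) (a *: d) ord0 i ⊙ mpartial F x i) = a * S.
    rewrite /S !hi_sum mulr_sumr; apply: eq_bigr => i _.
    by rewrite mxE hi_scaleM// ltW.
  (* Both terms carry the factor [a > 0]; what remains is [S + enorm d * hi (E (a *: d)) < 0]. *)
  rewrite -mulrA -mulrDr pmulr_rlt0//.
  have hiEad : hi (E (a *: d)) < - S / (enorm d + 1).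
    by near: a; exact: hiEray.
  rewrite addrC -ltrBrDr sub0r.
  rewrite (@le_lt_trans _ _ (enorm d * (- S / (enorm d + 1))))//.
    by rewrite ler_wpM2l ?enorm_ge0// ltW.
  (* Reduces to [enorm d / (enorm d + 1) < 1]. *)
  rewrite mulrCA gtr_pMr ?oppr_gt0//.
  by rewrite ltr_pdivrMr// mul1r ltrDl.
(* The radius of the right neighbourhood serves as the bound on the step length. *)
move=> /nbhs_ballP[r /= r0 rP]; exists r => // a /andP[a0 ar].
by apply: rP => //; rewrite -ball_normE /= sub0r normrN gtr0_norm.
Unshelve. all: by end_near. Qed.
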